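(* Let $G$ be a group and let $\varphi$ be an automorphism of $G$. Then for every positive integer $n$, $$h(\varphi)=h(\varphi\upharpoonright_{Z_n(G)})+h(\bar\varphi_{G/Z_n(G)}),$$ where $\varphi\upharpoonright_{Z_n(G)}$ is the restriction of $\varphi$ to the $n$-th term $Z_n(G)$ of the upper central series of $G$ and $\bar\varphi_{G/Z_n(G)}$ is the map induced by $\varphi$ on $G/Z_n(G)$.
   Context: Algebraic entropy: for a group $G$, an endomorphism $\phi$ of $G$ and a non-empty finite subset $F\subseteq G$, put $T_n(\phi,F)=F\,\phi(F)\cdots\phi^{n-1}(F)$ (product of subsets) for each integer $n\ge 1$, and $H(\phi,F)=\limsup_{n\to\infty}\frac1n\log|T_n(\phi,F)|$ (in fact a limit). The algebraic entropy of $\phi$ is $h(\phi)=\sup_F H(\phi,F)\in[0,\infty]$, where $F$ ranges over all non-empty finite subsets of $G$. Sums are taken in $[0,\infty]$ with the usual convention $x+\infty=\infty$. Upper central series: $Z_0(G)=\{1\}$ and $Z_{n+1}(G)/Z_n(G)=Z(G/Z_n(G))$ for $n\ge 0$, where $Z(\cdot)$ denotes the center. Each $Z_n(G)$ is a characteristic subgroup of $G$. *)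

(* Defs.v *)
From HB Require Import structures.
From mathcomp Require Import all_boot all_order all_algebra finmap.
From mathcomp Require Import all_classical all_reals all_analysis.

Set Implicit Arguments.
Unset Strict Implicit.
Unset Printing Implicit Defensive.

Local Open Scope group_scope.
Local Open Scope quotient_scope.

Record normal_subgroup (G : groupType) := NormalSubgroup {
  nsub_pred :> {pred G};
  nsub1 : 1 \in nsub_pred;
  nsubM : {in nsub_pred &, forall x y, x * y \in nsub_pred};
  nsubV : {in nsub_pred, forall x, x^-1 \in nsub_pred};
  nsubJ : forall x y, x \in nsub_pred -> x ^ y \in nsub_pred
}.

HB.instance Definition _ (G : groupType) (N : normal_subgroup G) :=
  isMulClosed.Build G (nsub_pred N) (@nsubM G N).
HB.instance Definition _ (G : groupType) (N : normal_subgroup G) :=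
  isMul1Closed.Build G (nsub_pred N) (nsub1 N).
HB.instance Definition _ (G : groupType) (N : normal_subgroup G) :=
  isInvClosed.Build G (nsub_pred N) (@nsubV G N).

Lemma nsub_group_closed (G : groupType) (N : normal_subgroup G) :
  group_closed (nsub_pred N).
Proof. by split; [exact: nsub1 | exact: gpredF]. Qed.

Definition nsub_type (G : groupType) (N : normal_subgroup G) : Type :=
  {x : G | x \in N}.

HB.instance Definition _ (G : groupType) (N : normal_subgroup G) :=
  SubChoice.on (nsub_type N).
HB.instance Definition _ (G : groupType) (N : normal_subgroup G) :=
  SubChoice_isSubGroup.Build G (nsub_pred N) (nsub_type N)
    (nsub_group_closed N).

Section Quotient.
Variables (G : groupType) (N : normal_subgroup G).

Definition cosetrel (x y : G) : bool := x^-1 * y \in N.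

Lemma cosetrel_is_equiv : equiv_class_of cosetrel.
Proof.
split=> [x|x y|y x z]; rewrite /cosetrel.
- by rewrite mulVg nsub1.
- by rewrite -[RHS](gpredV N) invgM invgK.
- by move=> xy yz; rewrite -[z](mulVKg y) mulgA gpredM.
Qed.

Canonical cosetrel_equiv := EquivRelPack cosetrel_is_equiv.
Canonical cosetrel_encModRel := defaultEncModRel cosetrel.

Definition nquot_type := {eq_quot cosetrel}.

HB.instance Definition _ : EqQuotient G cosetrel nquot_type :=
  EqQuotient.on nquot_type.
HB.instance Definition _ := Choice.on nquot_type.

Lemma pi_nquotP (x y : G) :
  reflect (\pi_nquot_type x = \pi_nquot_type y) (x^-1 * y \in N).
Proof. by apply: (iffP idP) => [xy|/eqP]; [apply/eqP|]; rewrite piE. Qed.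

Definition nquot_one : nquot_type := lift_cst nquot_type 1.
Definition nquot_mul := lift_op2 nquot_type (@monoid.mul G).
Definition nquot_inv := lift_op1 nquot_type (@monoid.inv G).

Lemma pi_nquot_mul : {morph \pi_nquot_type : x y / x * y >-> nquot_mul x y}.
Proof.
move=> x y; unlock nquot_mul; apply/pi_nquotP.
have /pi_nquotP Nx : \pi_nquot_type x = \pi_nquot_type (repr (\pi_nquot_type x)).
  by rewrite reprK.
have /pi_nquotP Ny : \pi_nquot_type y = \pi_nquot_type (repr (\pi_nquot_type y)).
  by rewrite reprK.
set x' := repr _ in Nx *; set y' := repr _ in Ny *.
have -> : (x * y)^-1 * (x' * y') = (x^-1 * x') ^ y * (y^-1 * y').
  by rewrite /conjg invgM !mulgA mulgK.
by rewrite gpredM // nsubJ.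
Qed.

Lemma pi_nquot_inv : {morph \pi_nquot_type : x / x^-1 >-> nquot_inv x}.
Proof.
move=> x; unlock nquot_inv; apply/pi_nquotP.
have /pi_nquotP Nx : \pi_nquot_type (repr (\pi_nquot_type x)) = \pi_nquot_type x.
  by rewrite reprK.
set x' := repr _ in Nx *.
have -> : x^-1^-1 * x'^-1 = (x'^-1 * x) ^ x'^-1.
  by rewrite /conjg !invgK !mulgA mulgV mul1g.
by rewrite nsubJ.
Qed.

Lemma nquot_mulA : associative nquot_mul.
Proof.
by elim/quotW=> x; elim/quotW=> y; elim/quotW=> z; rewrite -!pi_nquot_mul mulgA.
Qed.

Lemma nquot_oneE : nquot_one = \pi_nquot_type 1.
Proof. by rewrite /nquot_one; unlock. Qed.

Lemma nquot_mul1 : left_id nquot_one nquot_mul.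
Proof. by elim/quotW=> x; rewrite nquot_oneE -pi_nquot_mul mul1g. Qed.

Lemma nquot_mulr1 : right_id nquot_one nquot_mul.
Proof. by elim/quotW=> x; rewrite nquot_oneE -pi_nquot_mul mulg1. Qed.

Lemma nquot_mulV : left_inverse nquot_one nquot_inv nquot_mul.
Proof.
by elim/quotW=> x; rewrite -pi_nquot_inv -pi_nquot_mul mulVg nquot_oneE.
Qed.

Lemma nquot_mulrV : right_inverse nquot_one nquot_inv nquot_mul.
Proof.
by elim/quotW=> x; rewrite -pi_nquot_inv -pi_nquot_mul mulgV nquot_oneE.
Qed.

HB.instance Definition _ := isGroup.Build nquot_type
  nquot_mulA nquot_mul1 nquot_mulr1 nquot_mulV nquot_mulrV.

Definition nquot_pi (x : G) : nquot_type := \pi_nquot_type x.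

Lemma nquot_piM : {morph nquot_pi : x y / x * y}.
Proof. exact: pi_nquot_mul. Qed.

Lemma nquot_pi1 : nquot_pi 1 = 1.
Proof. by rewrite /nquot_pi -nquot_oneE. Qed.

HB.instance Definition _ := isUMagmaMorphism.Build G nquot_type nquot_pi
  (nquot_pi1, nquot_piM).

End Quotient.

Section Restriction.
Variables (G : groupType) (N : normal_subgroup G).
Variables (phi : UMagmaMorphism.type G G).
Hypothesis phiN : {in N, forall x, phi x \in N}.

Definition restr_fun (x : nsub_type N) : nsub_type N :=
  exist _ (phi (val x)) (phiN (valP x)).

Lemma restr_funM : {morph restr_fun : x y / x * y}.
Proof. by move=> x y; apply: val_inj; rewrite /= gmulfM. Qed.

Lemma restr_fun1 : restr_fun 1 = 1.
Proof. by apply: val_inj; rewrite /= gmulf1. Qed.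

HB.instance Definition _ :=
  isUMagmaMorphism.Build (nsub_type N) (nsub_type N) restr_fun
    (restr_fun1, restr_funM).

Definition restr_mor : UMagmaMorphism.type (nsub_type N) (nsub_type N) := restr_fun.

Definition induced_fun (c : nquot_type N) : nquot_type N :=
  nquot_pi N (phi (repr c)).

Lemma induced_funE (x : G) : induced_fun (nquot_pi N x) = nquot_pi N (phi x).
Proof.
apply/pi_nquotP.
have /pi_nquotP Nx : \pi_(nquot_type N) (repr (nquot_pi N x)) = nquot_pi N x.
  by rewrite reprK.
by have := phiN Nx; rewrite gmulfM gmulfV.
Qed.

Lemma induced_funM : {morph induced_fun : x y / x * y}.
Proof.
elim/quotW=> x; elim/quotW=> y; rewrite -!/(nquot_pi N _).
by rewrite -gmulfM !induced_funE -gmulfM -gmulfM.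
Qed.

Lemma induced_fun1 : induced_fun 1 = 1.
Proof. by rewrite -(nquot_pi1 N) induced_funE gmulf1. Qed.

HB.instance Definition _ :=
  isUMagmaMorphism.Build (nquot_type N) (nquot_type N) induced_fun
    (induced_fun1, induced_funM).

Definition induced_mor : UMagmaMorphism.type (nquot_type N) (nquot_type N) :=
  induced_fun.

End Restriction.

Definition is_central (G : groupType) (x : G) : Prop :=
  forall y : G, commute x y.

Section Trivial.
Variable G : groupType.

Definition trivial_pred : {pred G} := [pred x : G | x == 1].

Lemma trivial_pred1 : 1 \in trivial_pred.
Proof. by rewrite inE. Qed.
Lemma trivial_predM : {in trivial_pred &, forall x y, x * y \in trivial_pred}.
Proof. by move=> x y /eqP -> /eqP ->; rewrite mulg1 inE. Qed.
Lemma trivial_predV : {in trivial_pred, forall x, x^-1 \in trivial_pred}.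
Proof. by move=> x /eqP ->; rewrite invg1 inE. Qed.
Lemma trivial_predJ x y : x \in trivial_pred -> x ^ y \in trivial_pred.
Proof. by move=> /eqP ->; rewrite conj1g inE. Qed.

Definition trivial_nsub : normal_subgroup G :=
  NormalSubgroup trivial_pred1 trivial_predM trivial_predV trivial_predJ.

End Trivial.

Section CentralPreimage.
Variables (G : groupType) (N : normal_subgroup G).

Definition center_preim_pred : {pred G} :=
  [pred x : G | `[< is_central (nquot_pi N x) >]].

Lemma center_preimP x :
  reflect (is_central (nquot_pi N x)) (x \in center_preim_pred).
Proof. exact: asboolP. Qed.

Lemma center_preim1 : 1 \in center_preim_pred.
Proof. by apply/center_preimP => y; rewrite gmulf1; exact/commute_sym/commute1. Qed.

Lemma center_preimM :
  {in center_preim_pred &, forall x y, x * y \in center_preim_pred}.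
Proof.
move=> x y /center_preimP cx /center_preimP cy; apply/center_preimP => z.
by rewrite gmulfM /commute -mulgA cy !mulgA cx.
Qed.

Lemma center_preimV :
  {in center_preim_pred, forall x, x^-1 \in center_preim_pred}.
Proof.
move=> x /center_preimP cx; apply/center_preimP => z.
by rewrite gmulfV; apply/commute_sym/commuteV/commute_sym.
Qed.

Lemma center_preimJ x y :
  x \in center_preim_pred -> x ^ y \in center_preim_pred.
Proof.
move=> /center_preimP cx; apply/center_preimP => z.
by rewrite gmulfJ /conjg cx mulKg.
Qed.

Definition center_preim : normal_subgroup G :=
  NormalSubgroup center_preim1 center_preimM center_preimV center_preimJ.

End CentralPreimage.

(** [Z_(n+1)(G)] is the preimage in [G] of the center of [G / Z_n(G)]. *)
Fixpoint ucs (G : groupType) (n : nat) : normal_subgroup G :=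
  if n is m.+1 then center_preim (ucs G m) else trivial_nsub G.

Lemma ucs_stable (G : groupType) (phi : UMagmaMorphism.type G G)
    (phi_bij : bijective phi) (n : nat) : {in ucs G n, forall x, phi x \in ucs G n}.
Proof.
elim: n => [|n IHn] x; first by move=> /eqP ->; rewrite gmulf1 inE.
move=> /center_preimP cx; apply/center_preimP; elim/quotW=> y.
have [psi _ psiK] := phi_bij; rewrite -/(nquot_pi _ _) -[y]psiK.
have := congr1 (induced_mor IHn) (cx (nquot_pi _ (psi y))).
by rewrite !gmulfM /= !induced_funE.
Qed.

Arguments ucs_stable {G phi} phi_bij n [x] _.

Local Open Scope fset_scope.

Definition fset_mul (G : groupType) (A B : {fset G}) : {fset G} :=
  [fset (x * y)%g | x in A, y in B].

Definition trajectory (G : groupType) (phi : UMagmaMorphism.type G G)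
    (F : {fset G}) (n : nat) : {fset G} :=
  \big[@fset_mul G / [fset 1%g]]_(i < n) [fset iter i phi x | x in F].

(** The value of the sequence at [n = 0], where [_ / 0 = 0], is immaterial. *)
Definition entropy_at (R : realType) (G : groupType)
    (phi : UMagmaMorphism.type G G) (F : {fset G}) : \bar R :=
  limn_esup (fun n =>
    ((ln (#|` trajectory phi F n|%:R : R) / n%:R)%R)%:E).

Definition entropy (R : realType) (G : groupType)
    (phi : UMagmaMorphism.type G G) : \bar R :=
  ereal_sup [set entropy_at R phi F | F in [set F : {fset G} | F != fset0]].

(* Main.v *)
Require Import Defs.
From HB Require Import structures.
From mathcomp Require Import all_boot all_order all_algebra finmap.
From mathcomp Require Import all_classical all_reals all_analysis.
From mathcomp Require Import ring lra.

(** Write [h(M/N)] for the entropy relative to a stable normal subgroup [N]: the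
    supremum, over the non-empty finite sets [F] contained in [M], of the
    exponential growth rate of the number of cosets of [N] that meet [T_n(F)].
    All three entropies of the theorem have this form, as [h(G/1)], [h(Z_n/1)]
    and [h(G/Z_n)] ([entropy_relentropy], [entropy_restr], [entropy_induced]),
    so that everything takes place inside one group and no isomorphism between
    iterated quotients is ever needed.

    The core is [relentropy_chain]: [h(M/N1) = h(N2/N1) + h(M/N2)] whenever [N1]
    is contained in [N2], [N2] in [M], and [N2/N1] is central in [G/N1].

    - Lower bound. If [F] lies in [N2] and [E] in [M], centrality gives
      [T_n(FE) = T_n(F) T_n(E)] modulo [N1], and a product [AB] with [A] inside
      [N2] meets at least [|A/N1| |B/N2|] cosets of [N1].
    - Upper bound. Fix [F] and [m]. Choose a set [L] of representatives in
      [T_m(F)] of the cosets of [N2] that it meets; then [T_m(F)] is contained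
      in [L E] for the finite set [E], the part of [L^-1 T_m(F)] lying in [N2].
      As [T_(km)(F)] is the product of the images of [T_m(F)] under the
      endomorphisms [phi^(im)], and as [E] can be moved across everything modulo
      [N1], the set [T_(km)(F)] meets at most [|L|^k |T_(km)(E)/N1|] cosets of
      [N1]. Hence the rate of [F] modulo [N1] is at most
      [log |T_m(F)/N2| / m + h(N2/N1)], and [m] is arbitrary.

    By Fekete's lemma the growth rates are infima, over [n >= 1], of
    [log |T_n(F)/N| / n]. With this description both bounds become inequalities
    at a fixed [n], and no limit has to be manipulated.

    Since [Z_(k+1)/Z_k] is central in [G/Z_k], adding up the chain rule along the
    upper central series, once for [M = G] and once for [M = Z_n], gives the
    theorem ([relentropy_ucs]). *)

Set Implicit Arguments.
Unset Strict Implicit.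
Unset Printing Implicit Defensive.

Import Order.TTheory GRing.Theory Num.Theory numFieldNormedType.Exports.

Local Open Scope group_scope.
Local Open Scope fset_scope.

(** * Products of finite subsets *)

Section SetProduct.
Variable G : groupType.
Implicit Types A B C : {fset G}.

Lemma fset_mulP A B z :
  reflect (exists2 x, x \in A & exists2 y, y \in B & z = x * y)
          (z \in fset_mul A B).
Proof.
by apply: (iffP (@imfset2P _ _ _ (fun=> G) (fun x y => x * y) (mem A) (fun=> mem B) z)).
Qed.

Lemma mem_fset_mul A B x y : x \in A -> y \in B -> x * y \in fset_mul A B.
Proof. by move=> xA yB; apply/fset_mulP; exists x => //; exists y. Qed.

Lemma fset_mulA : associative (@fset_mul G).
Proof.
move=> A B C; apply/fsetP => z; apply/fset_mulP/fset_mulP.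
- case=> x xA [_ /fset_mulP[y yB [w wC ->]] ->].
  by exists (x * y); [exact: mem_fset_mul | exists w; rewrite // mulgA].
- case=> _ /fset_mulP[x xA [y yB ->]] [w wC ->].
  by exists x => //; exists (y * w); rewrite ?mulgA //; exact: mem_fset_mul.
Qed.

Lemma fset_mul1l : left_id [fset 1] (@fset_mul G).
Proof.
move=> A; apply/fsetP => z; apply/fset_mulP/idP.
- by case=> _ /fset1P -> [y yA ->]; rewrite mul1g.
- by move=> zA; exists 1; [exact: fset11 | exists z; rewrite ?mul1g].
Qed.

Lemma fset_mul1r : right_id [fset 1] (@fset_mul G).
Proof.
move=> A; apply/fsetP => z; apply/fset_mulP/idP.
- by case=> x xA [_ /fset1P -> ->]; rewrite mulg1.
- by move=> zA; exists z => //; exists 1; rewrite ?mulg1 ?fset11.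
Qed.

HB.instance Definition _ := Monoid.isLaw.Build {fset G} [fset 1] (@fset_mul G)
  fset_mulA fset_mul1l fset_mul1r.

Lemma fset_mulS A A' B B' :
  A `<=` A' -> B `<=` B' -> fset_mul A B `<=` fset_mul A' B'.
Proof.
move=> /fsubsetP sA /fsubsetP sB; apply/fsubsetP => _ /fset_mulP[x xA [y yB ->]].
by rewrite mem_fset_mul ?sA ?sB.
Qed.

Lemma fset_mul_neq0 A B : A != fset0 -> B != fset0 -> fset_mul A B != fset0.
Proof.
move=> /fset0Pn[x xA] /fset0Pn[y yB]; apply/fset0Pn.
by exists (x * y); exact: mem_fset_mul.
Qed.

Lemma leq_card_fset_mul A B : #|` fset_mul A B| <= #|` A| * #|` B|.
Proof.
rewrite -(size_allpairs (fun x y => x * y)) uniq_leq_size ?fset_uniq // => z.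
by case/fset_mulP => x xA [y yB ->]; apply/allpairsP; exists (x, y).
Qed.

End SetProduct.

Lemma imfset_fset_mul (G Q : groupType) (f : UMagmaMorphism.type G Q)
    (A B : {fset G}) :
  f @` fset_mul A B = fset_mul (f @` A) (f @` B).
Proof.
apply/fsetP => z; apply/imfsetP/fset_mulP => /=.
- case=> _ /fset_mulP[x xA [y yB ->]] ->.
  exists (f x); first exact: in_imfset.
  by exists (f y); [exact: in_imfset | rewrite gmulfM].
- case=> _ /imfsetP[x /= xA ->] [_ /imfsetP[y /= yB ->] ->].
  by exists (x * y); [exact: mem_fset_mul | rewrite gmulfM].
Qed.

Lemma imfset_neq0 (K L : choiceType) (f : K -> L) (A : {fset K}) :
  (f @` A != fset0) = (A != fset0).
Proof.
apply/fset0Pn/fset0Pn => -[x].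
- by case/imfsetP => y /= yA _; exists y.
- by move=> xA; exists (f x); exact: in_imfset.
Qed.

Lemma imfsetS (K L : choiceType) (f : K -> L) (A B : {fset K}) :
  A `<=` B -> f @` A `<=` f @` B.
Proof.
move=> /fsubsetP sAB; apply/fsubsetP => _ /imfsetP[x /= xA ->].
by rewrite in_imfset //= sAB.
Qed.

Lemma imfset_compose (K L M : choiceType) (f : K -> L) (g : L -> M)
  (A : {fset K}) : g @` (f @` A) = (g \o f) @` A.
Proof.
apply/fsetP => z; apply/imfsetP/imfsetP => /=.
- by case=> _ /imfsetP[x /= xA ->] ->; exists x.
- by case=> x xA ->; exists (f x) => //; exact: in_imfset.
Qed.

(** * Trajectories *)

Section Trajectory.
Variables (G : groupType) (phi : UMagmaMorphism.type G G).
Implicit Types F E : {fset G}.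

Lemma trajectory0 F : trajectory phi F 0 = [fset 1].
Proof. by rewrite /trajectory big_ord0. Qed.

Lemma iter_morphM i : {morph iter i phi : x y / x * y}.
Proof. by elim: i => // i IHi x y /=; rewrite IHi gmulfM. Qed.

Lemma iter_morph1 i : iter i phi 1 = 1.
Proof. by elim: i => //= i ->; rewrite gmulf1. Qed.

(** [imfset_fset_mul] asks for a bundled morphism, so the iterate is packed. *)
Lemma imfset_iterM i F E :
  iter i phi @` fset_mul F E = fset_mul (iter i phi @` F) (iter i phi @` E).
Proof.
pose it := isUMagmaMorphism.Build G G (iter i phi)
  (iter_morph1 i, @iter_morphM i).
pose f : UMagmaMorphism.type G G := HB.pack (iter i phi) it.
exact: (imfset_fset_mul f).
Qed.

(** A trajectory is cut into consecutive blocks, each the image of a shorter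
    trajectory; this gives subadditivity, and the block estimate below. *)
Lemma trajectoryD F m n :
  trajectory phi F (m + n) =
  fset_mul (trajectory phi F m) (iter m phi @` trajectory phi F n).
Proof.
rewrite /trajectory big_split_ord /=; congr fset_mul.
elim/big_rec2: _ => [|i A B _ ->].
  apply/fsetP => x; apply/fset1P/imfsetP => /=.
  - by move=> ->; exists 1; rewrite ?iter_morph1 ?fset11.
  - by case=> _ /fset1P -> ->; rewrite iter_morph1.
rewrite imfset_iterM imfset_compose; congr fset_mul.
by apply: eq_imfset => // x /=; rewrite iterD.
Qed.

Lemma trajectory1 F : trajectory phi F 1 = F.
Proof.
rewrite /trajectory big_ord_recl big_ord0 fset_mul1r.
apply/fsetP => x; apply/imfsetP/idP => /= [[y yF ->//]|xF]; by exists x.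
Qed.

Lemma trajectoryS F n :
  trajectory phi F n.+1 = fset_mul (trajectory phi F n) (iter n phi @` F).
Proof. by rewrite -addn1 trajectoryD trajectory1. Qed.

Lemma trajectory_neq0 F n : F != fset0 -> trajectory phi F n != fset0.
Proof.
move=> F0; elim: n => [|n IHn].
  by rewrite trajectory0; apply/fset0Pn; exists 1; exact: fset11.
by rewrite trajectoryS fset_mul_neq0 ?imfset_neq0.
Qed.

Lemma trajectory_sub (N : {pred G}) F n :
    1 \in N -> {in N &, forall x y, x * y \in N} ->
    {in N, forall x, phi x \in N} -> {subset F <= N} ->
  {subset trajectory phi F n <= N}.
Proof.
move=> N1 NM Nphi FN; elim: n => [|n IHn] x.
  by rewrite trajectory0 => /fset1P ->.
rewrite trajectoryS => /fset_mulP[y /IHn yN [_ /imfsetP[z /= zF ->] ->]].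
apply: NM => //; elim: (n) => [|i IHi]; [exact: FN | exact: Nphi].
Qed.

End Trajectory.

Lemma imfset_trajectory (G Q : groupType) (phi : UMagmaMorphism.type G G)
    (psi : UMagmaMorphism.type Q Q) (f : UMagmaMorphism.type G Q)
    (F : {fset G}) n : (forall x, f (phi x) = psi (f x)) ->
  f @` trajectory phi F n = trajectory psi (f @` F) n.
Proof.
move=> fphi; elim: n => [|n IHn].
  rewrite !trajectory0; apply/fsetP => x; apply/imfsetP/fset1P => /=.
  - by case=> _ /fset1P -> ->; rewrite gmulf1.
  - by move=> ->; exists 1; rewrite ?gmulf1 ?fset11.
rewrite !trajectoryS imfset_fset_mul IHn; congr fset_mul.
rewrite !imfset_compose; apply: eq_imfset => // x /=.
by elim: (n) => //= i IHi; rewrite fphi IHi.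
Qed.

(** * Transversals and central factors *)

(** The canonical choice operator selects the same element of [A] for all the
    elements of a fiber of [f]. *)
Lemma fset_transversal (K L : choiceType) (f : K -> L) (A : {fset K}) :
  exists B : {fset K},
    [/\ B `<=` A, f @` B = f @` A, {in B &, injective f} &
        #|` B| = #|` f @` A|].
Proof.
pose r x := choose (fun y => (y \in A) && (f y == f x)) x.
have rP x : x \in A -> r x \in A /\ f (r x) = f x.
  move=> xA; have : (r x \in A) && (f (r x) == f x).
    by apply: (@chooseP _ (fun y => (y \in A) && (f y == f x))); rewrite xA eqxx.
  by case/andP => ? /eqP.
have rE x y : x \in A -> y \in A -> f x = f y -> r x = r y.
  by move=> xA yA fxy; rewrite /r fxy; apply: choose_id; rewrite ?xA ?yA ?fxy eqxx.
have fB : f @` (r @` A) = f @` A.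
  rewrite imfset_compose; apply/fsetP => q; apply/imfsetP/imfsetP => /=.
  - by case=> x xA ->; exists x => //; have [] := rP x xA.
  - by case=> x xA ->; exists x => //; have [] := rP x xA.
have injB : {in r @` A &, injective f}.
  move=> _ _ /imfsetP[x /= xA ->] /imfsetP[y /= yA ->].
  by have [_ ->] := rP x xA; have [_ ->] := rP y yA; exact: rE.
exists (r @` A); split=> //; last by rewrite -fB [RHS]card_in_imfset.
by apply/fsubsetP => _ /imfsetP[x /= xA ->]; have [] := rP x xA.
Qed.

Section CentralTrajectory.
Variables (Q : groupType) (psi : UMagmaMorphism.type Q Q).
Implicit Types X Y E F L : {fset Q}.

(** The center is not stable under an arbitrary endomorphism, so centrality is
    required of the whole forward orbit. *)
Definition central_orbit X := forall i x, x \in X -> is_central (iter i psi x).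

Lemma central_trajectory X n x :
  central_orbit X -> x \in trajectory psi X n -> is_central x.
Proof.
move=> cX; elim: n x => [|n IHn] x.
  by rewrite trajectory0 => /fset1P -> y; exact/commute_sym/commute1.
rewrite trajectoryS => /fset_mulP[y /IHn cy [_ /imfsetP[z /= zX ->] ->]] t.
by rewrite /commute -mulgA (cX _ _ zX) !mulgA cy.
Qed.

Lemma fset_mul_centralC X Y :
  (forall x, x \in X -> is_central x) -> fset_mul X Y = fset_mul Y X.
Proof.
move=> cX; apply/fsetP => z; apply/fset_mulP/fset_mulP => -[x xA [y yB ->]].
- by exists y => //; exists x; rewrite // (cX _ xA).
- by exists y => //; exists x; rewrite // (cX _ yB).
Qed.

Lemma trajectory_mul X Y n : central_orbit X ->
  trajectory psi (fset_mul X Y) n =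
  fset_mul (trajectory psi X n) (trajectory psi Y n).
Proof.
move=> cX; elim: n => [|n IHn]; first by rewrite !trajectory0 fset_mul1l.
rewrite !trajectoryS IHn imfset_iterM -!fset_mulA; congr fset_mul.
rewrite !fset_mulA; congr fset_mul; symmetry; apply: fset_mul_centralC.
by move=> _ /imfsetP[x /= xX ->]; exact: cX.
Qed.

(** Replace each block [psi^(im)(T_m(F))] by [psi^(im)(L) psi^(im)(E)] and move the
    central factors to the right: the images of [L] accumulate in [P], those of
    [E] in [T_(km)(E)]. Having [1] in [E] makes [E] a subset of [T_m(E)], so that
    the sparse product of the [psi^(im)(E)] lies in the full trajectory. *)
Lemma trajectory_block F L E m k : (0 < m)%N -> central_orbit E -> 1 \in E ->
    trajectory psi F m `<=` fset_mul L E ->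
  exists2 P : {fset Q}, (#|` P| <= #|` L| ^ k)%N &
    trajectory psi F (k * m) `<=` fset_mul P (trajectory psi E (k * m)).
Proof.
case: m => // m _ cE E1 FLE.
have Esub : E `<=` trajectory psi E m.+1.
  elim: {FLE}m => [|m IHm]; first by rewrite trajectory1.
  rewrite trajectoryS -[X in X `<=` _]fset_mul1r; apply: fset_mulS => //.
  apply/fsubsetP => _ /fset1P ->; apply/imfsetP; exists 1 => //.
  by rewrite iter_morph1.
elim: k => [|k [P leP IHk]].
  exists [fset 1]; first by rewrite cardfs1.
  by rewrite !trajectory0 fset_mul1l.
rewrite mulSn addnC; set j := (k * m.+1)%N in IHk *.
exists (fset_mul P (iter j psi @` L)).
  rewrite expnSr; apply: leq_trans (leq_card_fset_mul _ _) _.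
  by apply: leq_mul => //; exact: leq_imfset_card.
rewrite !trajectoryD.
apply: (fsubset_trans (fset_mulS IHk (imfsetS (iter j psi) FLE))).
rewrite imfset_iterM -!fset_mulA fset_mulS // fset_mulA.
rewrite [X in fset_mul X _]fset_mul_centralC; last first.
  by move=> x; exact: central_trajectory.
by rewrite -fset_mulA fset_mulS // fset_mulS // imfsetS.
Qed.

End CentralTrajectory.

Section RelativeCardinal.
Variable G : groupType.
Implicit Types (N : normal_subgroup G) (A B : {fset G}).

Definition relcard N A : nat := #|` nquot_pi N @` A|.

Lemma nquot_piP N x y :
  reflect (nquot_pi N x = nquot_pi N y) (x^-1 * y \in N).
Proof. exact: pi_nquotP. Qed.

Lemma relcard_gt0 N A : (0 < relcard N A)%N = (A != fset0).
Proof. by rewrite /relcard cardfs_gt0 imfset_neq0. Qed.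

(** Multiply representatives of [A/N1] by representatives of [B/N2]: modulo [N2]
    a product determines its second factor, because [A] vanishes there; that
    factor can then be cancelled modulo [N1]. *)
Lemma relcard_mul_ge N1 N2 A B :
    {subset N1 <= N2} -> {subset A <= N2} ->
  (relcard N1 A * relcard N2 B <= relcard N1 (fset_mul A B))%N.
Proof.
move=> N12 AN2; rewrite /relcard.
have [A' [/fsubsetP sA _ injA <-]] := fset_transversal (nquot_pi N1) A.
have [B' [/fsubsetP sB _ injB <-]] := fset_transversal (nquot_pi N2) B.
pose f x y := nquot_pi N1 (x * y).
rewrite -(size_allpairs f) uniq_leq_size //.
  apply: allpairs_uniq; rewrite ?fset_uniq //.
  move=> _ _ /allpairsP[[x y] /= [xA yB ->]] /allpairsP[[u v] /= [uA vB ->]] /=.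
  rewrite /f => E1.
  have E2 : nquot_pi N2 (x * y) = nquot_pi N2 (u * v).
    by apply/nquot_piP/N12/nquot_piP.
  have piA z : z \in A' -> nquot_pi N2 z = 1.
    by move=> /sA/AN2 zN; rewrite -(nquot_pi1 N2); apply/nquot_piP; rewrite mulg1 gpredV.
  have yv : y = v.
    by apply: injB => //; move: E2; rewrite !nquot_piM (piA x) // (piA u) // !mul1g.
  move: E1; rewrite yv !nquot_piM => /mulIg xu.
  by rewrite (injA _ _ xA uA xu).
move=> _ /allpairsP[[x y] /= [/sA xA /sB yB ->]].
by apply: in_imfset; exact: mem_fset_mul.
Qed.

Section Morphism.
Variables (phi : UMagmaMorphism.type G G) (N1 N2 : normal_subgroup G).
Hypothesis stN1 : {in N1, forall x, phi x \in N1}.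
Hypothesis stN2 : {in N2, forall x, phi x \in N2}.

Hypothesis cN2 : {in N2, forall x, is_central (nquot_pi N1 x)}.
Implicit Types E F : {fset G}.

Lemma pi_trajectory F n :
  nquot_pi N1 @` trajectory phi F n =
  trajectory (induced_mor stN1) (nquot_pi N1 @` F) n.
Proof. by apply: imfset_trajectory => x; rewrite /= induced_funE. Qed.

Lemma central_orbit_pi F : {subset F <= N2} ->
  central_orbit (induced_mor stN1) (nquot_pi N1 @` F).
Proof.
move=> FN2 i _ /imfsetP[x /= /FN2 xN2 ->].
have -> : iter i (induced_mor stN1) (nquot_pi N1 x) = nquot_pi N1 (iter i phi x).
  by elim: i => //= i ->; rewrite induced_funE.
by apply: cN2; elim: i => //= i IHi; exact: stN2.
Qed.

Lemma relcard_trajectoryD F m n :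
  (relcard N1 (trajectory phi F (m + n)) <=
   relcard N1 (trajectory phi F m) * relcard N1 (trajectory phi F n))%N.
Proof.
rewrite /relcard !pi_trajectory trajectoryD.
apply: leq_trans (leq_card_fset_mul _ _) _.
by rewrite leq_mul // leq_imfset_card.
Qed.

Lemma relcard_trajectory_mul_ge F E n :
    {subset N1 <= N2} -> {subset F <= N2} ->
  (relcard N1 (trajectory phi F n) * relcard N2 (trajectory phi E n) <=
   relcard N1 (trajectory phi (fset_mul F E) n))%N.
Proof.
move=> N12 FN2; have TN2 : {subset trajectory phi F n <= N2}.
  by apply: trajectory_sub => //; [exact: nsub1 | exact: nsubM].
apply: leq_trans (relcard_mul_ge _ N12 TN2) _.
rewrite /relcard pi_trajectory !imfset_fset_mul trajectory_mul ?pi_trajectory //.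
exact: central_orbit_pi.
Qed.

(** The set [E] depends on [m], but not on [k]: this is what lets [k] tend to
    infinity before [m]. *)
Lemma relcard_trajectory_block F m : F != fset0 -> (0 < m)%N ->
  exists E : {fset G}, [/\ E != fset0, {subset E <= N2} &
    forall k, (relcard N1 (trajectory phi F (k * m)) <=
      relcard N2 (trajectory phi F m) ^ k *
      relcard N1 (trajectory phi E (k * m)))%N].
Proof.
move=> F0 m0; set A := trajectory phi F m.
have [L [/fsubsetP sL fL _ cardL]] := fset_transversal (nquot_pi N2) A.
pose E := [fset z in fset_mul (monoid.inv @` L) A | z \in N2].
have E1 : 1 \in E.
  have /fset0Pn[x xL] : L != fset0.
    by rewrite -(imfset_neq0 (nquot_pi N2)) fL imfset_neq0 trajectory_neq0.
  rewrite !inE nsub1 andbT -(mulVg x).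
  by apply: mem_fset_mul; [exact: in_imfset | exact: sL].
have EN2 : {subset E <= N2} by move=> x; rewrite !inE => /andP[].
have ALE : A `<=` fset_mul L E.
  apply/fsubsetP => x xA.
  have : nquot_pi N2 x \in nquot_pi N2 @` L by rewrite fL in_imfset.
  case/imfsetP => l /= lL /esym/nquot_piP lx.
  rewrite -[x](mulVKg l) mem_fset_mul // !inE lx andbT.
  by rewrite mem_fset_mul // in_imfset.
exists E; split=> // [|k]; first by apply/fset0Pn; exists 1.
have := @trajectory_block _ (induced_mor stN1) (nquot_pi N1 @` F)
  (nquot_pi N1 @` L) (nquot_pi N1 @` E) m k m0 (central_orbit_pi EN2).
case.
- by rewrite -(nquot_pi1 N1) in_imfset.
- by rewrite -pi_trajectory -imfset_fset_mul imfsetS.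
move=> P leP /fsubset_leq_card sub.
rewrite /relcard !pi_trajectory; apply: leq_trans sub _.
apply: leq_trans (leq_card_fset_mul _ _) _; rewrite leq_mul //.
apply: leq_trans leP _; rewrite /relcard -/A -cardL.
by case: k => // k; rewrite leq_exp2r // leq_imfset_card.
Qed.

End Morphism.

End RelativeCardinal.

Local Open Scope classical_set_scope.
Local Open Scope ring_scope.

(** * Growth rates of subadditive sequences *)

Section Rate.
Variable R : realType.
Implicit Type a b c : nat -> R.

(** The limit of [a n / n] when [a] is nonnegative and subadditive ([fekete]); the
    index is shifted to avoid [n = 0]. *)
Definition rate a : R := inf [set a n.+1 / n.+1%:R | n in [set: nat]].

Lemma le_rate a x : (forall n, (0 < n)%N -> x <= a n / n%:R) -> x <= rate a.
Proof.
move=> xa; apply: lb_le_inf; first by exists (a 1%N / 1), 0%N.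
by move=> _ [n _ <-]; exact: xa.
Qed.

Section NonnegSubadditive.
Variable a : nat -> R.
Hypothesis a_ge0 : forall n, 0 <= a n.

Let rate_lbound : has_inf [set a n.+1 / n.+1%:R | n in [set: nat]].
Proof.
split; first by exists (a 1%N / 1), 0%N.
by exists 0 => _ [n _ <-]; rewrite divr_ge0.
Qed.

Lemma rate_le n : (0 < n)%N -> rate a <= a n / n%:R.
Proof.
case: n => // n _; apply: ge_inf; first exact: rate_lbound.2.
by exists n.
Qed.

Hypothesis a_subadd : forall m n, a (m + n)%N <= a m + a n.

Lemma subadditive_mulD k m r : a (k * m + r)%N <= k%:R * a m + a r.
Proof.
elim: k => [|k IHk]; first by rewrite mul0r add0r.
have := a_subadd m (k * m + r); rewrite mulSn -addnA -natr1; lra.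
Qed.

Lemma subadditive_mul k m : (0 < k)%N -> a (k * m)%N <= k%:R * a m.
Proof.
case: k => // k _; rewrite mulSnr -natr1 mulrDl mul1r.
exact: subadditive_mulD.
Qed.

(** Divide [n] by an [M] for which [a M / M] nearly attains the infimum. The
    remainder contributes at most [C / n], where [C] bounds [a] below [M]. *)
Lemma fekete : (a n / n%:R) @[n --> \oo] --> rate a.
Proof.
apply/cvgrPdist_le => e e0.
have e2 : 0 < e / 2 by rewrite divr_gt0.
have [_ [m _ <-] am] := inf_adherent e2 rate_lbound.
set M := m.+1 in am; pose C := \sum_(r < M) a r.
have leC r : (r < M)%N -> a r <= C.
  by move=> rM; rewrite /C (bigD1 (Ordinal rM)) //= lerDl sumr_ge0.
near=> n.
have n0 : (0 < n)%N by near: n; exists 1%N.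
have nR : 0 < n%:R :> R by rewrite ltr0n.
rewrite ler_distlC; apply/andP; split.
  by apply: le_trans (rate_le n0); rewrite lerBlDr lerDl ltW.
have Cn : C / n%:R <= e / 2.
  rewrite ler_pdivrMr// mulrC -ler_pdivrMr//.
  by near: n; exact: nbhs_infty_ger.
have M0 : 0 < M%:R :> R by rewrite ltr0n.
apply: (@le_trans _ _ (a M / M%:R + C / n%:R)); last first.
  by rewrite [e]splitr addrA lerD// ltW.
rewrite -[a M / _](mulfK (lt0r_neq0 nR)) -mulrDl ler_pM2r ?invr_gt0//.
rewrite {1}(divn_eq n M) (le_trans (subadditive_mulD _ _ _))//.
apply: lerD; last by rewrite leC// ltn_mod.
rewrite mulrAC mulrC -mulrA ler_wpM2l// ler_pdivlMr// -natrM ler_nat.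
exact: leq_divM.
Unshelve. all: by end_near.
Qed.

Lemma limn_esup_rate : limn_esup (fun n => (a n / n%:R)%:E) = (rate a)%:E.
Proof.
have /cvg_limn_einf_sup[_ ->//] : (fun n => (a n / n%:R)%:E) @ \oo --> (rate a)%:E.
by apply: cvg_EFin; [exact: nearW | exact: fekete].
Qed.

End NonnegSubadditive.
End Rate.

(** * Relative entropy and its chain rule *)

Lemma ln_nat_ge0 (R : realType) n : 0 <= ln n%:R :> R.
Proof. by case: n => [|n]; [rewrite ln0 | rewrite ln_ge0// ler1n]. Qed.

Lemma ln_natM_le (R : realType) (m n p : nat) : (0 < p)%N -> (p <= m * n)%N ->
  ln p%:R <= ln m%:R + ln n%:R :> R.
Proof.
move=> p0 pmn; have : (0 < m * n)%N by exact: leq_trans pmn.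
rewrite muln_gt0 => /andP[m0 n0].
by rewrite -lnM ?posrE ?ltr0n// -natrM ler_ln ?posrE ?ltr0n ?muln_gt0 ?m0// ler_nat.
Qed.

(** Finiteness in [B] and a nonnegative element in each set exclude the indeterminate
    form [+oo - oo] when a term is moved across an inequality. *)
Lemma ereal_supD_eq (R : realType) (A B C : set \bar R) :
    (exists2 x, A x & 0 <= x)%E -> (exists2 y, B y & 0 <= y)%E ->
    (forall y, B y -> y \is a fin_num) ->
    (forall x y, A x -> B y -> exists2 z, C z & x + y <= z)%E ->
    (forall z, C z -> z <= ereal_sup A + ereal_sup B)%E ->
  (ereal_sup C = ereal_sup A + ereal_sup B)%E.
Proof.
move=> [x0 Ax0 x0_ge0] [y0 By0 y0_ge0] finB ABC CAB; apply/eqP; rewrite eq_le.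
apply/andP; split; first by apply: ge_ereal_sup => z /CAB.
have A0 : (0 <= ereal_sup A)%E by exact: le_trans x0_ge0 (ereal_sup_ubound Ax0).
have B0 : (0 <= ereal_sup B)%E by exact: le_trans y0_ge0 (ereal_sup_ubound By0).
have step y : B y -> (ereal_sup A + y <= ereal_sup C)%E.
  move=> By; rewrite -leeBrDr ?finB//; apply: ge_ereal_sup => x Ax.
  rewrite leeBrDr ?finB//; have [z Cz xyz] := ABC _ _ Ax By.
  by apply: (le_trans xyz); exact: ereal_sup_ubound.
have [Aoo|Afin] := eqVneq (ereal_sup A) +oo%E.
  have := step _ By0; rewrite Aoo addye; last by rewrite gt_eqF// (lt_le_trans _ y0_ge0) ?ltNy0.
  by rewrite leye_eq => /eqP ->; exact: leey.
have fA : ereal_sup A \is a fin_num by rewrite ge0_fin_numE// ltey.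
rewrite addeC -leeBrDr//; apply: ge_ereal_sup => y By.
by rewrite leeBrDr// addeC; exact: step.
Qed.

Section RelativeEntropy.
Variables (R : realType) (G : groupType) (phi : UMagmaMorphism.type G G).
Implicit Types (N : normal_subgroup G) (M : {pred G}) (E F : {fset G}).

Definition relrate N F : R := rate (fun n => ln (relcard N (trajectory phi F n))%:R).

Definition relentropy N M : \bar R :=
  ereal_sup [set (relrate N F)%:E | F in [set F | F != fset0 /\ {subset F <= M}]].

Lemma relrate_ge0 N F : 0 <= relrate N F.
Proof. by apply: le_rate => n _; rewrite divr_ge0 ?ln_nat_ge0. Qed.

Section Chain.
Variables (N1 N2 : normal_subgroup G) (M : {pred G}).
Hypothesis stN1 : {in N1, forall x, phi x \in N1}.
Hypothesis stN2 : {in N2, forall x, phi x \in N2}.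
Hypothesis cN2 : {in N2, forall x, is_central (nquot_pi N1 x)}.
Hypothesis N12 : {subset N1 <= N2}.
Hypothesis N2M : {subset N2 <= M}.
Hypothesis MM : {in M &, forall x y, (x * y)%g \in M}.

(** Superadditivity at each [n] passes to the infima. *)
Lemma relrate_mul F E : F != fset0 -> E != fset0 -> {subset F <= N2} ->
  relrate N1 F + relrate N2 E <= relrate N1 (fset_mul F E).
Proof.
move=> F0 E0 FN2; apply: le_rate => n n0.
have step := relcard_trajectory_mul_ge stN1 stN2 cN2 E n N12 FN2.
have pos N D : D != fset0 -> 0 < (relcard N (trajectory phi D n))%:R :> R.
  by move=> D0; rewrite ltr0n relcard_gt0 trajectory_neq0.
apply: le_trans (lerD (rate_le _ n0) (rate_le _ n0)) _;
  [by move=> ?; exact: ln_nat_ge0 ..|].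
rewrite -mulrDl ler_pM2r ?invr_gt0 ?ltr0n// -lnM ?posrE ?pos//.
by rewrite -natrM ler_ln ?posrE ?pos ?fset_mul_neq0// ?ler_nat// natrM mulr_gt0 ?pos.
Qed.

(** Evaluate the infimum for [F] at [j * m] and bound [T_(jm)(E)] by
    subadditivity: after division by [j * m] only [log |T_j(E)/N1| / j] remains
    from [E], and [j] is arbitrary. *)
Lemma relrate_le_block F m : F != fset0 -> (0 < m)%N ->
  exists E, [/\ E != fset0, {subset E <= N2} & relrate N1 F <=
     relrate N1 E + ln (relcard N2 (trajectory phi F m))%:R / m%:R].
Proof.
move=> F0 m0.
have [E [E0 EN2 FE]] := relcard_trajectory_block stN1 stN2 cN2 F0 m0.
exists E; split=> //; rewrite -lerBlDr; apply: le_rate => j j0.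
have jm0 : (0 < j * m)%N by rewrite muln_gt0 j0.
rewrite lerBlDr (le_trans (rate_le _ jm0))//; first by move=> ?; exact: ln_nat_ge0.
pose a F k : R := ln (relcard N1 (trajectory phi F k))%:R.
have asub k l : a E (k + l)%N <= a E k + a E l.
  apply: ln_natM_le; first by rewrite relcard_gt0 trajectory_neq0.
  exact: relcard_trajectoryD.
have j0R : 0 < j%:R :> R by rewrite ltr0n.
have m0R : 0 < m%:R :> R by rewrite ltr0n.
rewrite ler_pdivrMr ?ltr0n// natrM mulrDl.
set u := ln _; set v := ln _; set w := ln _.
have -> : v / j%:R * (j%:R * m%:R) + w / m%:R * (j%:R * m%:R) = j%:R * w + m%:R * v.
  by field; rewrite !gt_eqF.
apply: le_trans (ln_natM_le _ _ (FE j)) _.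
  by rewrite relcard_gt0 trajectory_neq0.
rewrite lerD//; last by rewrite mulnC; apply: (subadditive_mul asub).
rewrite natrX lnXn ?ltr0n ?relcard_gt0 ?trajectory_neq0//.
by rewrite -[leLHS]mulr_natl.
Qed.

(** The lower bound is [relrate_mul] and the upper bound [relrate_le_block]. The
    latter has content only when [h(N2/N1)] is finite, and this number then
    absorbs the rates of all the sets [E] obtained as [m] varies. *)
Lemma relentropy_chain :
  (relentropy N1 M = relentropy N1 N2 + relentropy N2 M)%E.
Proof.
have F1 : [fset 1%g] != fset0 :> {fset G} by apply/fset0Pn; exists 1%g; exact: fset11.
apply: ereal_supD_eq.
- exists (relrate N1 [fset 1%g])%:E; rewrite ?lee_fin ?relrate_ge0//.
  by exists [fset 1%g] => //; split=> // x /fset1P ->; exact: nsub1.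
- exists (relrate N2 [fset 1%g])%:E; rewrite ?lee_fin ?relrate_ge0//.
  by exists [fset 1%g] => //; split=> // x /fset1P ->; apply: N2M; exact: nsub1.
- by move=> _ [F _ <-].
- move=> _ _ [F [F0 FN2] <-] [E [E0 EM] <-].
  exists (relrate N1 (fset_mul F E))%:E; last by rewrite -EFinD lee_fin relrate_mul.
  exists (fset_mul F E) => //; split; first exact: fset_mul_neq0.
  by move=> _ /fset_mulP[x /FN2/N2M xM [y /EM yM ->]]; exact: MM.
- move=> _ [F [F0 FM] <-].
  rewrite -/(relentropy N1 N2) -/(relentropy N2 M).
  have supF : ((relrate N2 F)%:E <= relentropy N2 M)%E.
    by apply: ereal_sup_ubound; exists F.
  have ge0 : (0 <= relentropy N1 N2)%E.
    apply: (@le_trans _ _ (relrate N1 [fset 1%g])%:E).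
      by rewrite lee_fin relrate_ge0.
    apply: ereal_sup_ubound; exists [fset 1%g] => //; split=> // x /fset1P ->.
    exact: nsub1.
  apply: (@le_trans _ _ (relentropy N1 N2 + (relrate N2 F)%:E)%E); last exact: leeD2l.
  case E12 : (relentropy N1 N2) ge0 => [s| |] // _; last by rewrite addye ?leey.
  rewrite -EFinD lee_fin -lerBlDl.
  apply: le_rate => m m0.
  have [E [E0 EN2 FE]] := relrate_le_block F0 m0.
  rewrite lerBlDl (le_trans FE)// lerD2r -lee_fin -E12.
  by apply: ereal_sup_ubound; exists E.
Qed.

End Chain.
End RelativeEntropy.

(** * Restricted and induced entropies as relative entropies *)

Local Open Scope fset_scope.

(** The upper limit in the definition of entropy is the infimum [rate]. *)
Lemma entropyE (R : realType) (G : groupType) (phi : UMagmaMorphism.type G G) :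
  entropy R phi = ereal_sup
  [set (rate (fun n => ln #|` trajectory phi F n|%:R : R))%:E | F in [set F | F != fset0]].
Proof.
congr ereal_sup; apply: eq_imagel => F /= F0.
apply: limn_esup_rate => [n|m n]; first exact: ln_nat_ge0.
apply: ln_natM_le; first by rewrite cardfs_gt0 trajectory_neq0.
rewrite trajectoryD; apply: leq_trans (leq_card_fset_mul _ _) _.
by rewrite leq_mul // leq_imfset_card.
Qed.

Lemma relcard_trivial (G : groupType) (F : {fset G}) :
  relcard (trivial_nsub G) F = #|` F|.
Proof.
rewrite /relcard card_imfset //= => x y /nquot_piP /eqP xy.
by rewrite -[y](mulVKg x) xy mulg1.
Qed.

Section Bridges.
Variables (R : realType) (G : groupType) (phi : UMagmaMorphism.type G G).

Lemma entropy_relentropy : entropy R phi = relentropy R phi (trivial_nsub G) predT.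
Proof.
rewrite entropyE; congr ereal_sup; apply/seteqP; split => t /= [F].
- move=> F0 <-; exists F => //; congr (rate _)%:E; apply/funext => n.
  by rewrite relcard_trivial.
- case=> F0 _ <-; exists F => //; congr (rate _)%:E; apply/funext => n.
  by rewrite relcard_trivial.
Qed.

Section Stable.
Variable N : normal_subgroup G.
Hypothesis stN : {in N, forall x, phi x \in N}.

Lemma entropy_restr :
  entropy R (restr_mor stN) = relentropy R phi (trivial_nsub G) N.
Proof.
have valT (F : {fset nsub_type N}) n :
    #|` trajectory (restr_mor stN) F n| =
    relcard (trivial_nsub G) (trajectory phi (\val @` F) n).
  rewrite relcard_trivial -(@imfset_trajectory _ _ (restr_mor stN) phi \val)//.
  by rewrite card_imfset //; exact: val_inj.
rewrite entropyE; congr ereal_sup; apply/seteqP; split => t /= [F].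
- move=> F0 <-; exists (\val @` F).
    by rewrite imfset_neq0; split=> // _ /imfsetP[x /= _ ->]; exact: valP.
  by congr (rate _)%:E; apply/funext => n; rewrite valT.
- case=> F0 FN <-.
  have valF : \val @` [fset (insubd 1%g x : nsub_type N) | x in F] = F.
    apply/fsetP => x; rewrite imfset_compose; apply/imfsetP/idP => /=.
    + by case=> y yF ->; rewrite insubdK ?FN.
    + by move=> xF; exists x => //; rewrite insubdK ?FN.
  exists [fset (insubd 1%g x : nsub_type N) | x in F]; first by rewrite imfset_neq0.
  by congr (rate _)%:E; apply/funext => n; rewrite valT valF.
Qed.

Lemma entropy_induced :
  entropy R (induced_mor stN) = relentropy R phi N predT.
Proof.
have piT F n : relcard N (trajectory phi F n) =
    #|` trajectory (induced_mor stN) (nquot_pi N @` F) n|.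
  by rewrite -pi_trajectory.
pose lift (q : nquot_type N) : G := repr q.
have liftK q : nquot_pi N (lift q) = q by exact: reprK.
rewrite entropyE; congr ereal_sup; apply/seteqP; split => t /= [F].
- move=> F0 <-; exists (lift @` F); first by rewrite imfset_neq0.
  congr (rate _)%:E; apply/funext => n; rewrite piT imfset_compose.
  congr (ln (#|` trajectory _ _ n|)%:R); apply/fsetP => x; apply/imfsetP/idP => /=.
  + by case=> y yF ->; rewrite liftK.
  + by move=> xF; exists x => //; rewrite liftK.
- case=> F0 _ <-; exists (nquot_pi N @` F); first by rewrite imfset_neq0.
  by congr (rate _)%:E; apply/funext => n; rewrite piT.
Qed.

End Stable.
End Bridges.

Lemma ucs_central (G : groupType) n :
  {in ucs G n.+1, forall x, is_central (nquot_pi (ucs G n) x)}.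
Proof. by move=> x /center_preimP. Qed.

Lemma ucs_subS (G : groupType) n : {subset ucs G n <= ucs G n.+1}.
Proof.
move=> x xN; apply/center_preimP => y.
have -> : nquot_pi (ucs G n) x = 1%g.
  by rewrite -(nquot_pi1 (ucs G n)); apply/nquot_piP; rewrite mulg1 gpredV.
exact/commute_sym/commute1.
Qed.

(** The statement is for all [M] so that the induction hypothesis can be used both
    for [M] and for the next term of the series. *)
Lemma relentropy_ucs (R : realType) (G : groupType)
    (phi : UMagmaMorphism.type G G) n (M : {pred G}) :
    (forall k, {in ucs G k, forall x, phi x \in ucs G k}) ->
    {subset ucs G n.+1 <= M} -> {in M &, forall x y, (x * y)%g \in M} ->
  (relentropy R phi (trivial_nsub G) M =
   relentropy R phi (trivial_nsub G) (ucs G n.+1) + relentropy R phi (ucs G n.+1) M)%E.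
Proof.
move=> st; elim: n M => [|n IHn] M sM MM.
  exact: (relentropy_chain R (st 0%N) (st 1%N) (@ucs_central _ 0) (@ucs_subS _ 0)).
have sub := @ucs_subS G n.+1.
rewrite IHn => [|x /sub /sM//|//].
rewrite [X in _ = (X + _)%E]IHn; [|exact: sub|exact: nsubM].
rewrite -addeA; congr (_ + _)%E.
exact: (relentropy_chain R (st n.+1) (st n.+2) (@ucs_central _ n.+1) sub).
Qed.

Theorem proposition4p9 (R : realType) (G : groupType)
    (phi : UMagmaMorphism.type G G) (phi_bij : bijective phi)
    (n : nat) (n_gt0 : (0 < n)%N) :
  (entropy R phi =
     entropy R (restr_mor (ucs_stable phi_bij n)) +
     entropy R (induced_mor (ucs_stable phi_bij n)))%E.
Proof.
rewrite entropy_restr entropy_induced entropy_relentropy.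
case: n n_gt0 => // n _; apply: relentropy_ucs => // k x.
exact: ucs_stable.
Qed.
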